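(* Let $G$ be a finite simple graph. The gyrochromatic number $\chi_g(G)$ is equal to \[\inf_{\substack{N\in\mathbb{N},\ S\subseteq\mathbb{Z}_N \\ G\to C(N,S)}}\chi_f\left(C(N,S)\right)=\inf_{\substack{N\in\mathbb{N},\ S\subseteq\mathbb{Z}_N \\ G\to C(N,S)}}\frac{N}{\alpha\left(C(N,S)\right)},\] where the infima range over all positive integers $N$ and all sets $S\subseteq\mathbb{Z}_N$ with $S=-S$ and $0\notin S$ such that $G$ is homomorphic to $C(N,S)$. That is, $\chi_g(G)$ is the infimum of the fractional chromatic numbers of the circulant graphs that admit a homomorphism from $G$.
   Context: Let $\mathbb{T}=\mathbb{R}/\mathbb{Z}$ with Haar (Lebesgue) probability measure $\mu$. A set $A\subseteq \mathbb{T}$ is a coloring $\mathbb{T}$-base for $G$ if there exists a function $f:V(G)\to \mathbb{T}$ such that $A+f(u)$ and $A+f(v)$ are disjoint for every edge $uv$ of $G$. Let $\sigma_{\mathbb{T}}(G)=\sup\{\mu(A): A \text{ is a Borel coloring } \mathbb{T}\text{-base for } G\}$ and $\chi_g(G)=1/\sigma_{\mathbb{T}}(G)$ (the gyrochromatic number). For $N\in\mathbb{N}$ and $S\subseteq\mathbb{Z}_N=\mathbb{Z}/N\mathbb{Z}$ with $S=-S$ and $0\notin S$, the circulant graph $C(N,S)$ has vertex set $\mathbb{Z}_N$, with $i$ and $j$ adjacent iff $j-i\in S$. $G\to H$ means there is a graph homomorphism from $G$ to $H$, i.e. a map $V(G)\to V(H)$ sending edges to edges. $\alpha$ is the independence number.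 The fractional chromatic number $\chi_f(H)$ is the smallest real $z$ for which there is an assignment of non-negative weights to the independent sets of $H$ with total weight $z$ such that for each vertex the total weight of independent sets containing it is at least one. *)

(* Defs.v *)
From HB Require Import structures.
From mathcomp Require Import all_boot all_order all_algebra.
From mathcomp Require Import all_classical all_reals all_analysis.
From mathcomp Require Import measurable_realfun.

Set Implicit Arguments.
Unset Strict Implicit.
Unset Printing Implicit Defensive.

Import Order.TTheory GRing.Theory Num.Theory.
Import numFieldNormedType.Exports.

Local Open Scope classical_set_scope.
Local Open Scope ring_scope.

Section Circle.
Variable R : realType.

(* The quotient group R/Z: [ideal_quot] takes the quotient of a zmodType by any
   additive subgroup; [Num.int_num_subdef] is the predicate behind [Num.int]. *)
Definition circle_group : Type :=
  {ideal_quot GRing.ZmodClosed.clone R (@Num.int_num_subdef R) _}.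
HB.instance Definition _ := GRing.Zmodule.on circle_group.
HB.instance Definition _ := generic_quotient.Quotient.on circle_group.

(* carries the quotient topology, the Borel sigma-algebra and the group law *)
Definition circle : Type := quotient_topology circle_group.
HB.instance Definition _ := GRing.Zmodule.copy circle circle_group.
HB.instance Definition _ := Topological.on circle.
HB.instance Definition _ := isPointed.Build circle 0.
HB.instance Definition _ :=
  Measurable.copy circle (@g_sigma_algebraType circle (@open circle)).

Definition to_circle (x : R) : circle := \pi_(circle_group)%qT x.

Lemma to_circle_surj (t : circle) : exists x, to_circle x = t.
Proof. by exists (repr (t : circle_group)); rewrite /to_circle reprK. Qed.

Lemma to_circleD : {morph to_circle : x y / x + y}.
Proof. by move=> x y; exact: (Quotient.pi_add _ x y). Qed.

Lemma to_circle_eq (x y : R) :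
  to_circle x = to_circle y <-> x - y \is a Num.int.
Proof.
have := Quotient.idealrBE (GRing.ZmodClosed.clone R (@Num.int_num_subdef R) _) x y.
move=> E; split=> [/eqP h|h]; first by rewrite -[_ \is a _]/(_ \in _) E.
by apply/eqP; rewrite -E.
Qed.

Lemma open_circleE (U : set circle) : open U = open (to_circle @^-1` U).
Proof. by []. Qed.

Lemma measurable_circleE : @measurable _ circle = <<s @open circle >>.
Proof. by []. Qed.

Lemma measurable_to_circle : measurable_fun setT (to_circle : R -> circle).
Proof.
have h := @measurability _ _ _ _ setT (to_circle : R -> circle) _ measurable_circleE.
apply: h => _ [U oU <-].
by rewrite setTI; apply: open_measurable; rewrite -open_circleE.
Qed.

(* Haar probability measure, realized from the fundamental domain [0, 1[ *)
Definition haar : set circle -> \bar R :=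
  pushforward (mrestr lebesgue_measure (measurable_itv `[0, 1[)) to_circle.

Let haar0 : haar set0 = 0%E.
Proof. by rewrite /haar /pushforward /mrestr preimage_set0 set0I measure0. Qed.

Let haar_ge0 A : (0 <= haar A)%E.
Proof. by rewrite /haar /pushforward /mrestr measure_ge0. Qed.

Let haar_sigma_additive : semi_sigma_additive haar.
Proof.
move=> F mF tF mUF; rewrite /haar /pushforward preimage_bigcup.
apply: measure_semi_sigma_additive.
- by move=> n; rewrite -[X in measurable X]setTI; exact: measurable_to_circle.
- apply/trivIsetP => /= i j _ _ ij; rewrite -preimage_setI.
  by move/trivIsetP : tF => /(_ _ _ _ _ ij) ->//; rewrite preimage_set0.
- rewrite -preimage_bigcup -[X in measurable X]setTI.
  exact: measurable_to_circle.
Qed.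

HB.instance Definition _ :=
  isMeasure.Build _ _ _ haar haar0 haar_ge0 haar_sigma_additive.

Let haarT : haar setT = 1%E.
Proof.
rewrite /haar /pushforward /mrestr preimage_setT setTI.
by rewrite lebesgue_measure_itv /= lte_fin ltr01 oppr0 adde0.
Qed.

HB.instance Definition _ := Measure_isProbability.Build _ _ _ haar haarT.

End Circle.

Section Graphs.
Variables (R : realType) (V : finType) (e : rel V).

Definition translate (A : set (circle R)) (t : circle R) : set (circle R) :=
  [set a + t | a in A].

Definition coloring_base (A : set (circle R)) : Prop :=
  exists f : V -> circle R,
    forall u v, e u v -> translate A (f u) `&` translate A (f v) = set0.

Definition sigma_circle : R :=
  sup [set fine (haar A) | A in [set A | measurable A /\ coloring_base A]].

Definition gyrochromatic_number : R := sigma_circle^-1.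

Definition independent (A : {set V}) : bool :=
  [forall u in A, forall v in A, ~~ e u v].

Definition independence_number : nat :=
  \max_(A : {set V} | independent A) #|A|.

Definition fractional_coloring (w : {set V} -> R) : Prop :=
  (forall A, independent A -> 0 <= w A) /\
  (forall v, 1 <= \sum_(A : {set V} | independent A && (v \in A)) w A).

Definition coloring_weight (w : {set V} -> R) : R :=
  \sum_(A : {set V} | independent A) w A.

(* For loopless [e] this infimum is attained: [fractional_chromatic_min] *)
Definition fractional_chromatic_number : R :=
  inf [set coloring_weight w | w in fractional_coloring].

Lemma fractional_chromatic_min : irreflexive e ->
  exists2 w, fractional_coloring w &
    coloring_weight w = fractional_chromatic_number /\
    forall w', fractional_coloring w' -> coloring_weight w <= coloring_weight w'.
Proof.
move=> eI.
have ind1 v : independent [set v]%SET.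
  by apply/forall_inP => x /set1P ->; apply/forall_inP => y /set1P ->; rewrite eI.
pose K : set (prod_topology (fun _ : {set V} => R)) :=
  [set w | (forall A, w A \in `[0, 1]) /\ fractional_coloring w].
have cont (P : pred {set V}) :
    continuous (fun w : prod_topology (fun _ : {set V} => R) => \sum_(A | P A) w A).
  apply: (@continuous_big R^o _ +%R 0 P (@add_continuous R^o)) => A _ w.
  exact: (@proj_continuous _ (fun _ : {set V} => R) A w).
have cK : compact K.
  pose C : set (prod_topology (fun _ : {set V} => R)) :=
    [set w | forall A, w A \in `[0, 1]].
  have cC : compact C.
    have := @tychonoff {set V} (fun _ => R : topologicalType)
      (fun _ => [set` `[0, 1]%R]) (fun _ => @segment_compact _ _ _).
    exact.
  have clF v : closed [set w : prod_topology (fun _ : {set V} => R) |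
                 1 <= \sum_(A | independent A && (v \in A)) w A].
    apply: (@preimage_closed _ R _ [set x | 1 <= x]) (@closed_ge R 1) => w _.
    exact: cont.
  have -> : K = C `&` \bigcap_v [set w : prod_topology (fun _ : {set V} => R) |
                 1 <= \sum_(A | independent A && (v \in A)) w A].
    apply/seteqP; split=> [w [w01 [_ w1]]|w [w01 w1]]; first by split=> // v _; apply: w1.
    split=> //; split=> [A _|v]; last exact: w1.
    by have := w01 A; rewrite in_itv/= => /andP[].
  apply: compact_closedI => //.
  by apply: closed_bigI => v _; exact: clF.
have K0 : K !=set0.
  exists (fun=> 1); split=> [A|]; first by rewrite in_itv/= ler01 lexx.
  split=> [//|v].
  rewrite (bigD1 [set v]%SET) /=; last by rewrite ind1 set11.
  by rewrite lerDl sumr_ge0.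
have [w /set_mem[_ Fw] wmin] := compact_EVT_min K0 cK
  (continuous_subspaceT (cont (fun A => independent A))).
have min w' : fractional_coloring w' -> coloring_weight w <= coloring_weight w'.
  move=> [w0 w1].
  pose t A := if independent A then Num.min (w' A) 1 else 0.
  have t0 A : 0 <= t A by rewrite /t; case: ifP => // /w0; rewrite le_min ler01 => ->.
  apply: (@le_trans _ _ (coloring_weight t)); last first.
    by apply: ler_sum => A iA; rewrite /t iA ge_min lexx.
  apply: wmin; rewrite inE; split=> [A|].
    rewrite in_itv/= t0 /t; case: ifP => _; last exact: ler01.
    by rewrite ge_min lexx orbT.
  split=> [A _ //|v].
  have [/existsP[A /andP[/andP[iA vA] wA]]|/existsPn nA] :=
    boolP [exists A : {set V}, independent A && (v \in A) && (1 <= w' A)].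
    rewrite (bigD1 A) /=; last by rewrite iA.
    rewrite {1}/t iA (min_idPr wA) lerDl; exact: sumr_ge0.
  rewrite (le_trans (w1 v))// le_eqVlt; apply/orP; left; apply/eqP.
  apply: eq_bigr => A /andP[iA vA]; rewrite /t iA.
  have := nA A; rewrite iA vA /= -ltNge => /ltW wA.
  by rewrite (min_idPl wA).
exists w => //; split=> //; apply/le_anti/andP; split; last first.
  by apply: ge_inf; [exists 0 => _ [w' [w0 _] <-]; exact: sumr_ge0|exists w].
by apply: lb_le_inf; [exists (coloring_weight w), w|move=> _ [w' Fw' <-]; exact: min].
Qed.

End Graphs.

Definition graph_hom (V W : finType) (e : rel V) (e' : rel W) : Prop :=
  exists h : V -> W, forall u v, e u v -> e' (h u) (h v).

(* ['I_n.+1] is the additive group Z/(n+1)Z, including the trivial group at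
   n = 0; the order N of a circulant graph is written n.+1 throughout. *)
Definition connection_set (n : nat) (S : {set 'I_n.+1}) : Prop :=
  [set (- s)%R | s in S]%SET = S /\ 0 \notin S.

Definition circulant (n : nat) (S : {set 'I_n.+1}) : rel 'I_n.+1 :=
  fun i j => j - i \in S.

(* Main.v *)
Require Import Defs.
From mathcomp Require Import all_boot all_order all_algebra.
From mathcomp Require Import all_classical all_reals all_analysis.
From mathcomp Require Import measurable_realfun zify lra ring.
Set Implicit Arguments.
Unset Strict Implicit.
Unset Printing Implicit Defensive.
Import Order.TTheory GRing.Theory Num.Theory.
Import numFieldNormedType.Exports.
Local Open Scope classical_set_scope.
Local Open Scope ring_scope.

(* If [I] is independent in [C(N, S)], the union of the arcs
   [(i/N, (i+1)/N)], [i \in I], is a coloring base of measure [#|I| / N] for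
   every graph mapping to [C(N, S)]. Conversely, a coloring base [A] contains up
   to [eps] in measure a compact set [K]; the finitely many translates of [K]
   attached to adjacent vertices are at positive distance, so for large [N] the
   shifts may be rounded to multiples of [1/N] and [K] thickened to the cells
   [[i/N, (i+1)/N)] that it meets. The indices of these cells form an
   independent set of the circulant graph whose connection set consists of the
   differences of rounded shifts along edges. Finally [chi_f = N / alpha] for a
   circulant graph, by vertex transitivity. *)

(** * Independence numbers of finite and circulant graphs *)

Lemma independent_attained (V : finType) (e : rel V) :
  exists2 I : {set V}, independent e I & #|I| = independence_number e.
Proof.
have i0 : independent e finset.set0.
  by apply/forall_inP => x; rewrite inE.
have [|I iI E] := @eq_bigmax_cond _ (fun A => independent e A) (fun A => #|A|).
  by apply/card_gt0P; exists finset.set0.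
by exists I.
Qed.

Lemma leq_independence_number (V : finType) (e : rel V) (I : {set V}) :
  independent e I -> (#|I| <= independence_number e)%N.
Proof. by move=> iI; apply: leq_bigmax_cond. Qed.

Lemma independence_number_gt0 (n : nat) (S : {set 'I_n.+1}) :
  connection_set S -> (0 < independence_number (circulant S))%N.
Proof.
move=> [_ S0]; rewrite -(cards1 (0 : 'I_n.+1)).
apply: leq_independence_number.
apply/forall_inP => x /set1P ->; apply/forall_inP => y /set1P ->.
by rewrite /circulant subrr.
Qed.

Section GyrochromaticNumber.
Variable R : realType.

(** * Fractional chromatic number of circulant graphs *)

(** Double counting: summing the covering inequalities over all vertices counts the weight of each
    independent set [A] exactly [#|A|] times, hence at most [independence_number e] times. *)
Lemma card_le_fractional (V : finType) (e : rel V) (w : {set V} -> R) :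
  fractional_coloring e w ->
  #|V|%:R <= (independence_number e)%:R * coloring_weight e w.
Proof.
move=> [w0 w1].
have -> : #|V|%:R = \sum_(v : V) (1 : R) by rewrite sumr_const.
apply: (le_trans (ler_sum _ (fun v _ => w1 v))).
under eq_bigr do rewrite big_mkcondr.
rewrite exchange_big /= /coloring_weight mulr_sumr.
apply: ler_sum => A iA.
rewrite -big_mkcond /= sumr_const -[leLHS]mulr_natl ler_wpM2r ?w0 // ler_nat.
exact: leq_independence_number.
Qed.

Lemma sum_eqop_scale (T : finType) (P : pred T) (a : T) (c : R) :
  P a -> \sum_(x | P x) (x == a)%:R * c = c.
Proof.
move=> Pa; rewrite (bigD1 a)//= eqxx mul1r big1 ?addr0// => x /andP[_ /negbTE ->].
by rewrite mul0r.
Qed.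

(* The [N] translates of a maximum independent set, each with weight
   [1 / alpha], cover every vertex exactly once. *)
Lemma fractional_chromatic_circulant (n : nat) (S : {set 'I_n.+1}) :
  connection_set S ->
  fractional_chromatic_number R (circulant S) =
    n.+1%:R / (independence_number (circulant S))%:R.
Proof.
move=> cS; set e := circulant S.
have a0 : 0 < (independence_number e)%:R :> R.
  by rewrite ltr0n independence_number_gt0.
have [I iI cI] := independent_attained e.
pose shift (t : 'I_n.+1) : {set 'I_n.+1} := [set i : 'I_n.+1 | i - t \in I]%SET.
have ishift t : independent e (shift t).
  apply/forall_inP => x; rewrite inE => xI; apply/forall_inP => y; rewrite inE => yI.
  move/forall_inP: iI => /(_ _ xI) /forall_inP /(_ _ yI).
  by rewrite /e /circulant opprB addrA subrK.
(* Different [t] may give the same translate, so the weights are accumulated with multiplicity. *)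
pose w (A : {set 'I_n.+1}) : R :=
  \sum_t (A == shift t)%:R * (independence_number e)%:R^-1.
have wE : coloring_weight e w = n.+1%:R / (independence_number e)%:R.
  rewrite /coloring_weight exchange_big /=.
  under eq_bigr do rewrite sum_eqop_scale//.
  by rewrite sumr_const card_ord mulr_natl.
have fw : fractional_coloring e w.
  split=> [A _|v].
    by apply: sumr_ge0 => t _; rewrite mulr_ge0// invr_ge0 ltW.
  rewrite exchange_big /=.
  rewrite (eq_bigr (fun t : 'I_n.+1 =>
      (v - t \in I)%:R / (independence_number e)%:R)).
    rewrite (reindex_inj (inv_inj (subKr v))) /=.
    rewrite -mulr_suml -natr_sum.
    under eq_bigr do rewrite subKr.
    rewrite -big_mkcond/= sum1_card cI divff ?gt_eqF//.
  move=> t _; have [vI|vI] := boolP (v - t \in I).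
    rewrite mul1r sum_eqop_scale// ishift/= inE//.
  rewrite mul0r big1// => A /andP[_ vA]; case: eqP => [AE|_]; last by rewrite mul0r.
  by move: vA; rewrite AE inE (negbTE vI).
apply/le_anti/andP; split.
  rewrite -wE; apply: ge_inf; last by exists w.
  by exists 0 => _ [w' [w0 _] <-]; exact: sumr_ge0.
apply: lb_le_inf; first by exists (coloring_weight e w), w.
move=> _ [w' fw' <-]; rewrite ler_pdivrMr// mulrC.
by have := card_le_fractional fw'; rewrite card_ord.
Qed.

(** * Residues mod [N], grid cells, and coloring bases made of cells *)

(** Turns an identity of residues into one of reals with an explicit wrap-around [m], ready to be
    combined with inequalities. Only sums occur, because the representative of an opposite is not
    the opposite of the representative. *)
Lemma ord_addr_eq (n : nat) (a b c d : 'I_n.+1) :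
  a + d = b + c <->
  exists m : int, (a : nat)%:R + (d : nat)%:R =
                  (b : nat)%:R + (c : nat)%:R + m%:~R * n.+1%:R :> R.
Proof.
have -> : (a + d = b + c) <-> (n.+1%:Z %| (a + d)%N%:Z - (b + c)%N%:Z)%Z.
  rewrite -eqz_mod_dvd !modz_nat eqz_nat.
  by split=> [/(congr1 val)/= ->|/eqP h]//; exact: val_inj.
split=> [/dvdzP[m mE]|[m mE]]; [exists m|apply/dvdzP; exists m].
  rewrite -!natrD -[n.+1%:R]/(n.+1%:Z%:~R) -intrM -mE intrB.
  by rewrite -!pmulrn addrC subrK.
apply: (@intr_inj R); rewrite intrM intrB -!pmulrn !natrD.
by rewrite mE -!addrA addrC; ring.
Qed.

Lemma to_circle_fract (t : circle R) :
  exists2 x : R, 0 <= x < 1 & to_circle x = t.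
Proof.
have [x <-] := to_circle_surj t.
exists (x - (Num.floor x)%:~R).
  by have := floor_itv x; rewrite intrD; lra.
apply/to_circle_eq.
by rewrite (_ : _ - _ = - (Num.floor x)%:~R) ?rpredN ?intr_int//; ring.
Qed.

(* [[i/N, (i+1)/N)] if [b], the open interval otherwise *)
Definition cell (b : bool) (n i : nat) : set R :=
  [set` Interval (BSide b (i%:R / n.+1%:R)) (BLeft (i.+1%:R / n.+1%:R))].

Lemma cellP b n i x : cell b n i x ->
  i%:R <= x * n.+1%:R < i%:R + 1 /\ (~~ b -> i%:R < x * n.+1%:R).
Proof.
rewrite /cell /= in_itv /= ltr_pdivlMr// -[i.+1%:R]natr1.
by case: b; rewrite /= ?ler_pdivrMr ?ltr_pdivrMr// => /andP[h ->]; rewrite ?h ?ltW.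
Qed.

Lemma exists_cell n x : 0 <= x < 1 -> exists i : 'I_n.+1, cell true n i x.
Proof.
move=> /andP[x0 x1].
have xN0 : 0 <= x * n.+1%:R by rewrite mulr_ge0.
have lt : (Num.truncn (x * n.+1%:R) < n.+1)%N.
  by rewrite truncn_lt_nat// -[ltRHS]mul1r ltr_pM2r.
exists (Ordinal lt).
by rewrite /cell /= in_itv /= ler_pdivrMr// ltr_pdivlMr// truncn_itv.
Qed.

Lemma measure_cell (b : bool) (n i : nat) :
  lebesgue_measure (cell b n i) = (n.+1%:R^-1)%:E.
Proof.
rewrite /cell lebesgue_measure_itv /= lte_fin ltr_pM2r ?invr_gt0//.
by rewrite ltr_nat ltnSn -EFinB -mulrBl -natr1 addrAC subrr add0r mul1r.
Qed.

Lemma measure_cells (b : bool) (n : nat) (I : {set 'I_n.+1}) :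
  lebesgue_measure (\big[setU/set0]_(i in I) cell b n i) =
  (#|I|%:R / n.+1%:R)%:E.
Proof.
rewrite measure_bigsetU_ord.
- rewrite (eq_bigr (fun=> (n.+1%:R^-1)%:E)) => [|i _]; last exact: measure_cell.
  by rewrite sumEFin sumr_const mulr_natl.
- by move=> i; exact: measurable_itv.
- apply/trivIsetP => /= i j _ _ ij; apply/seteqP; split=> // x [].
  move=> /cellP[hi _] /cellP[hj _]; case/negP: ij; apply/eqP/val_inj => /=.
  (* The index of a cell can be read off any of its points by truncation, so distinct cells are
     disjoint. *)
  have ti : Num.truncn (x * n.+1%:R) = i.
    by apply: truncn_def; rewrite -[i.+1%:R]natr1.
  have tj : Num.truncn (x * n.+1%:R) = j.
    by apply: truncn_def; rewrite -[j.+1%:R]natr1.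
  exact: etrans (esym ti) tj.
Qed.

(* The arcs are open so that their union is Borel for the quotient topology;
   vertex [u] is sent to [- h u / N]. *)
Lemma coloring_base_of_circulant (V : finType) (e : rel V) (n : nat)
    (S : {set 'I_n.+1}) (I : {set 'I_n.+1}) :
  graph_hom e (circulant S) -> independent (circulant S) I ->
  exists A : set (circle R), [/\ measurable A, coloring_base e A &
    #|I|%:R / n.+1%:R <= fine (haar A)].
Proof.
move=> [h hP] iI.
have N0 : 0 < n.+1%:R :> R by [].
pose U : set R := \big[setU/set0]_(i in I) cell false n i.
have UP x : U x -> exists2 i, i \in I & cell false n i x.
  apply: (big_ind (fun B : set R => B x -> _)) => [//|B C hB hC [/hB|/hC]//|].
  by move=> i iI' ?; exists i.
have oU : open U.
  rewrite /U; apply: big_ind; [exact: open0|exact: openU|move=> i _].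
  exact: interval_open.
have mU : measurable U by exact: open_measurable.
pose A : set (circle R) := @to_circle R @` U.
have mA : measurable A.
  rewrite measurable_circleE; apply: sub_sigma_algebra; rewrite open_circleE.
  (* The preimage of the image consists of all integer translates of [U], so it is open. *)
  have -> : @to_circle R @^-1` A = \bigcup_(m : int) ((fun x => x + m%:~R) @^-1` U).
    apply/seteqP; split=> [x [y Uy] /to_circle_eq /intrP[m mE]|x [m _] /= Um].
      by exists m => //=; rewrite -mE addrC subrK.
    exists (x + m%:~R) => //; apply/to_circle_eq.
    by rewrite addrAC subrr add0r intr_int.
  apply: bigcup_open => m _; apply: open_comp => // x _.
  by apply: cvgD; [exact: cvg_id|exact: cvg_cst].
exists A; split => //.
  exists (fun v => to_circle (- ((h v : nat)%:R / n.+1%:R))) => u v euv.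
  apply/seteqP; split=> // t [[_ [x Ux <-] <-]] [_ [y Uy <-]].
  rewrite -!to_circleD => /esym/to_circle_eq /intrP[m mE].
  have [i iI' /cellP[xi /(_ isT) xi']] := UP _ Ux.
  have [j jI' /cellP[yj /(_ isT) yj']] := UP _ Uy.
  have E : x * n.+1%:R - (h u : nat)%:R - (y * n.+1%:R - (h v : nat)%:R)
           = m%:~R * n.+1%:R :> R.
    by rewrite -mE !mulrDl !mulNr !mulrDl ?mulNr !divfK ?gt_eqF//.
  have F : (i : nat)%:R + (h v : nat)%:R =
           (j : nat)%:R + (h u : nat)%:R + m%:~R * n.+1%:R :> R.
    (* By [E], [z] equals [(y N - j) - (x N - i)] with [N = n.+1]. Both brackets lie strictly
       between 0 and 1, so the integer [z] vanishes. *)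
    pose z : int := (i : nat)%:Z + (h v : nat)%:Z - (j : nat)%:Z
                    - (h u : nat)%:Z - m * n.+1%:Z.
    have zE : z%:~R = (i : nat)%:R + (h v : nat)%:R - (j : nat)%:R - (h u : nat)%:R
                     - m%:~R * n.+1%:R :> R.
      by rewrite /z !intrB intrD intrM -!pmulrn.
    have z_gtN1 : -1 < z by rewrite -(ltr_int R) zE rmorphN1; lra.
    have z_lt1 : z < 1 by rewrite -(ltr_int R) zE; lra.
    have z0 : z = 0 by lia.
    by move: zE; rewrite z0; lra.
  have /ord_addr_eq G : exists m : int, (i : nat)%:R + (h v : nat)%:R =
           (j : nat)%:R + (h u : nat)%:R + m%:~R * n.+1%:R :> R by exists m.
  move/forall_inP: iI => /(_ _ iI') /forall_inP /(_ _ jI') /negP; apply.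
  rewrite /circulant.
  have -> : j - i = h v - h u.
    by rewrite -[j](addrK (h u)) -G addrAC [i + _]addrC addrK.
  exact: hP.
rewrite -lee_fin fineK ?fin_num_measure// -(measure_cells false).
rewrite /haar /pushforward /mrestr le_measure ?inE//.
  apply: measurableI => //; rewrite -[X in measurable X]setTI.
  exact: measurable_to_circle.
move=> x Ux; split; first by exists x.
have [i _ /cellP[/andP[xi xi'] _]] := UP _ Ux.
rewrite /= in_itv/=; apply/andP; split.
  by rewrite -(pmulr_lge0 _ N0) (le_trans _ xi).
rewrite -(ltr_pM2r N0) mul1r (lt_le_trans xi')//.
by rewrite natr1 ler_nat.
Qed.

(** * Discretizing a coloring base to a circulant graph *)

(** A local bound on the distance to the integers becomes uniform by compactness. The [\near] form
    lets the bounds for finitely many edges be intersected. *)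
Lemma compact_away_from_int (L : set R) :
  compact L -> (forall x, L x -> x \isn't a Num.int) ->
  \forall d \near 0^'+, forall x, L x -> forall m : int, d <= `|x - m%:~R|.
Proof.
move=> /compact_near_coveringP cL Lint.
apply: (cL _ _ (fun d x => forall m : int, d <= `|x - m%:~R|)) => x /Lint xint.
(* Half the distance from [x] to the nearest integer: points within [d] of [x] keep distance at
   least [d] from every integer. *)
pose d := Num.min (x - (Num.floor x)%:~R) ((Num.floor x)%:~R + 1 - x) / 2.
have /andP[fx xf] := floor_itv x.
have d0 : 0 < d.
  rewrite divr_gt0// lt_min !subr_gt0 lt_neqAle fx andbT.
  rewrite -[1]/(1%:~R) -intrD xf andbT.
  by apply: contra xint => /eqP <-; rewrite intr_int.
have dm (m : int) : d *+ 2 <= `|x - m%:~R|.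
  rewrite -mulr_natr divfK//.
  have [mf|mf] := leP m (Num.floor x).
    rewrite ge_min (le_trans _ (ler_norm _))// lerD2l lerN2 ler_int//.
  rewrite ge_min; apply/orP; right; rewrite distrC (le_trans _ (ler_norm _))//.
  by rewrite lerD2r -[1]/(1%:~R) -intrD ler_int; lia.
near=> y c => m /=.
have yx : `|x - y| < d by near: y; exact: cvgr_dist_lt.
have cd : c < d by near: c; exact: nbhs_right_lt.
have := ler_distD y x m%:~R; have := dm m; rewrite mulr2n; lra.
Unshelve. all: by end_near. Qed.

(* Inner regularity makes the disjointness quantitative, so that a fine enough
   grid separates the rounded translates of the compact set [K]. *)
Lemma circulant_of_coloring_base (V : finType) (e : rel V) (e_sym : symmetric e)
    (A : set (circle R)) (eps : R) :
  measurable A -> coloring_base e A -> 0 < eps -> eps < fine (haar A) ->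
  exists (n : nat) (S : {set 'I_n.+1}), [/\ connection_set S,
    graph_hom e (circulant S) &
    fine (haar A) - eps <= (independence_number (circulant S))%:R / n.+1%:R].
Proof.
move=> mA [f fP] eps0 epsA.
pose B : set R := @to_circle R @^-1` A `&` `[0, 1[.
have mB : measurable B.
  apply: measurableI => //; rewrite -[X in measurable X]setTI.
  exact: measurable_to_circle.
have muB : lebesgue_measure B = (fine (haar A))%:E.
  by rewrite fineK// fin_num_measure.
have muBfin : (lebesgue_measure B < +oo)%E by rewrite muB ltry.
have [K [cK KB muBK]] := lebesgue_regularity_inner mB muBfin eps0.
have mK : measurable K by exact: compact_measurable.
have muK : ((fine (haar A) - eps)%:E <= lebesgue_measure K)%E.
  have muE : lebesgue_measure B =
      (lebesgue_measure (B `\` K) + lebesgue_measure K)%E.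
    by have := measureDI lebesgue_measure mB mK; rewrite (setIidr KB).
  rewrite EFinB leeBlDr// -muB muE addeC leeD2l//; exact: ltW.
have K01 k : K k -> 0 <= k < 1 by move=> /KB[_]; rewrite /= in_itv.
have [x x01 xf] : exists2 x : V -> R, (forall v, 0 <= x v < 1) &
    forall v, to_circle (x v) = f v.
  have /choice[x xP] : forall v, exists y : R, 0 <= y < 1 /\ to_circle y = f v.
    by move=> v; have [y y01 yf] := to_circle_fract (f v); exists y.
  by exists x => v; have [] := xP v.
have Ksep u v : e u v -> forall y, [set p.1 + x v - (p.2 + x u) | p in K `*` K] y ->
    y \isn't a Num.int.
  move=> euv _ [[k k'] /= [/KB[Ak _] /KB[Ak' _]] <-].
  apply/negP => /to_circle_eq; rewrite !to_circleD !xf => kk'.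
  suff : (translate A (f u) `&` translate A (f v)) (to_circle k' + f u).
    by rewrite fP.
  by split; [exists (to_circle k') | exists (to_circle k)].
have cL u v : compact [set p.1 + x v - (p.2 + x u) | p in K `*` K].
  apply: continuous_compact; last exact: compact_setX.
  apply: continuous_subspaceT => p.
  by apply: cvgB; apply: cvgD;
    [exact: cvg_fst|exact: cvg_cst|exact: cvg_snd|exact: cvg_cst].
have [d d0 dP] : exists2 d : R, 0 < d & forall u v, e u v ->
    forall k k', K k -> K k' -> forall m : int, d <= `|k + x v - (k' + x u) - m%:~R|.
  have H : \forall d \near (0:R)^'+, forall p : V * V, e p.1 p.2 ->
    forall y, [set q.1 + x p.2 - (q.2 + x p.1) | q in K `*` K] y ->
    forall m : int, d <= `|y - m%:~R|.
    apply: filter_forall => -[u v] /=.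
    have [euv|_] := boolP (e u v); last by apply: nearW.
    apply: filterS (compact_away_from_int (cL u v) (Ksep _ _ euv)) => d + _; exact.
  have [d [dP d0]] := filter_ex (filterI H (nbhs_right_gt (0:R))).
  exists d => // u v euv k k' Kk Kk'.
  by apply: (dP (u, v) euv); exists (k, k').
(* Rounding [k], [x v], [k'] and [x u] down to the grid makes four errors in [[0, 1/N)], two of each
   sign. They total less than [2/N < d] in absolute value, which yields [Isep] below. *)
pose n := Num.truncn (2 / d).
have nd : 2 < d * n.+1%:R by rewrite mulrC -ltr_pdivrMr// truncnS_gt.
have N0 : 0 < n.+1%:R :> R by [].
have [h hP] : exists h : V -> 'I_n.+1,
    forall v, (h v : nat)%:R <= x v * n.+1%:R < (h v : nat)%:R + 1.
  have /choice[h hP] v := exists_cell n (x01 v).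
  by exists h => v; have [] := cellP (hP v).
pose I : {set 'I_n.+1} :=
  [set i : 'I_n.+1 | `[< exists2 k, K k & cell true n i k >]]%SET.
have IP i : i \in I ->
    exists2 k, K k & (i : nat)%:R <= k * n.+1%:R < (i : nat)%:R + 1.
  by rewrite inE => /asboolP[k Kk /cellP[ik _]]; exists k.
have KI : K `<=` \big[setU/set0]_(i in I) cell true n i.
  move=> k Kk; have [i ki] := exists_cell n (K01 _ Kk).
  have iI : i \in I by rewrite inE; apply/asboolP; exists k.
  by rewrite (bigD1 _ iI); left.
have muI : fine (haar A) - eps <= #|I|%:R / n.+1%:R.
  rewrite -lee_fin (le_trans muK)// -(measure_cells true) le_measure ?inE//.
  by apply: bigsetU_measurable => i _; exact: measurable_itv.
have Isep u v i j : e u v -> i \in I -> j \in I -> i + h v <> j + h u.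
  move=> euv /IP[k Kk ki] /IP[k' Kk' k'j] /ord_addr_eq[m mE].
  have := dP _ _ euv _ _ Kk Kk' m; rewrite leNgt => /negP; apply.
  rewrite -(ltr_pM2r N0) (lt_trans _ nd)//.
  rewrite -[X in _ * X](gtr0_norm N0) -normrM.
  have := hP u; have := hP v; rewrite !mulrBl !mulrDl => hv hu.
  by rewrite ltr_norml; lra.
pose S : {set 'I_n.+1} :=
  [set s | [exists u, exists v, e u v && (s == h v - h u)]]%SET.
have SP s : reflect (exists u v, e u v /\ s = h v - h u) (s \in S).
  rewrite inE; apply: (iffP existsP).
  - move=> [u /existsP[v /andP[euv /eqP ->]]].
    by exists u, v.
  - move=> [u [v [euv ->]]]; exists u; apply/existsP; exists v.
    by rewrite euv eqxx.
have SN s : s \in S -> - s \in S.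
  by move=> /SP[u [v [euv ->]]]; apply/SP; exists v, u; rewrite e_sym opprB.
exists n, S; split.
- split.
    apply/setP => s; apply/imsetP/idP => [[t tS ->]|sS]; first exact: SN.
    by exists (- s); rewrite ?opprK ?SN.
  (* An edge with [h u = h v] would contradict [Isep] at [i = j]. This requires [I] to be nonempty,
     which follows from [eps < fine (haar A)]. *)
  have [i iI] : exists i, i \in I.
    apply/set0Pn; apply/eqP => I0; move: muI.
    by rewrite I0 cards0 mul0r; lra.
  apply/negP => /SP[u [v [euv /esym/subr0_eq huv]]].
  by apply: (Isep _ _ _ _ euv iI iI); rewrite huv.
- by exists h => u v euv; apply/SP; exists u, v.
- rewrite (le_trans muI)// ler_pM2r ?invr_gt0// ler_nat leq_independence_number//.
  apply/forall_inP => i iI; apply/forall_inP => j jI.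
  apply/negP => /SP[u [v [euv ji]]].
  apply: (Isep _ _ _ _ euv iI jI).
  by rewrite -[j](subrK i) ji addrAC subrK addrC.
Qed.

(** * Comparison of [sigma_circle] with the infimum over circulant graphs *)

Lemma sigma_circle_ub (V : finType) (e : rel V) (A : set (circle R)) :
  measurable A -> coloring_base e A -> fine (haar A) <= sigma_circle R e.
Proof.
move=> mA bA; apply: ub_le_sup; last by exists A.
exists 1 => _ [B [mB _] <-].
by rewrite -lee_fin fineK ?fin_num_measure// probability_le1.
Qed.

End GyrochromaticNumber.

(** All nonzero residues as connection set give a complete graph on [#|V| + 1] vertices, into which
    [V] embeds by enumeration. Hence the infima range over nonempty sets. *)
Lemma graph_hom_complete (V : finType) (e : rel V) : irreflexive e ->
  exists (n : nat) (S : {set 'I_n.+1}),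
    connection_set S /\ graph_hom e (circulant S).
Proof.
move=> e_irr; exists #|V|, [set~ 0]%SET; split; first split.
- apply/setP => s; rewrite !inE; apply/imsetP/idP => [[t + ->]|s0].
    by rewrite !inE oppr_eq0.
  by exists (- s); rewrite ?opprK// !inE oppr_eq0.
- by rewrite !inE eqxx.
exists (fun v => widen_ord (leqnSn _) (enum_rank v)) => u v euv.
rewrite /circulant !inE subr_eq0; apply/eqP => /(congr1 val) /= /val_inj.
by move=> /enum_rank_inj vu; rewrite vu e_irr in euv.
Qed.

Theorem theorem4 (R : realType) (V : finType) (e : rel V)
    (e_sym : symmetric e) (e_irr : irreflexive e) :
  gyrochromatic_number R e =
    inf [set z : R | exists (n : nat) (S : {set 'I_n.+1}),
      [/\ connection_set S, graph_hom e (circulant S) &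
          z = fractional_chromatic_number R (circulant S)]] /\
  inf [set z : R | exists (n : nat) (S : {set 'I_n.+1}),
      [/\ connection_set S, graph_hom e (circulant S) &
          z = fractional_chromatic_number R (circulant S)]] =
    inf [set z : R | exists (n : nat) (S : {set 'I_n.+1}),
      [/\ connection_set S, graph_hom e (circulant S) &
          z = n.+1%:R / (independence_number (circulant S))%:R]].
Proof.
set Zf := (X in inf X = _); set Za := (X in _ = inf X).
have ZfE : Zf = Za.
  apply/seteqP; split=> z [n [S [cS hS ->]]]; exists n, S; split=> //.
    exact: fractional_chromatic_circulant.
  by rewrite fractional_chromatic_circulant.
suff gE : gyrochromatic_number R e = inf Za.
  by split; [rewrite gE -ZfE|rewrite ZfE].
have Za0 : Za !=set0.
  have [n [S [cS hS]]] := graph_hom_complete e_irr.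
  by exists (n.+1%:R / (independence_number (circulant S))%:R), n, S.
have sigma_ge z : Za z -> 0 < z /\ z^-1 <= sigma_circle R e.
  move=> [n [S [cS hS ->]]]; split.
    by rewrite divr_gt0// ltr0n independence_number_gt0.
  have [I iI cI] := independent_attained (circulant S).
  have [A [mA bA muA]] := coloring_base_of_circulant R hS iI.
  by rewrite invf_div -cI (le_trans muA)// sigma_circle_ub.
have [z0 Zz0] := Za0.
have [z0_gt0 z0_sigma] := sigma_ge _ Zz0.
(* Positivity of [sigma_circle] and of [inf Za] is established first, since inversion reverses the
   order only among positive reals. *)
have sigma0 : 0 < sigma_circle R e by rewrite (lt_le_trans _ z0_sigma)// invr_gt0.
have sigma_inf : (sigma_circle R e)^-1 <= inf Za.
  apply: lb_le_inf => // z Zz; have [z_gt0 z_sigma] := sigma_ge _ Zz.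
  by rewrite -[z]invrK lef_pV2 ?posrE ?invr_gt0.
have inf0 : 0 < inf Za by rewrite (lt_le_trans _ sigma_inf)// invr_gt0.
apply/le_anti/andP; split; first exact: sigma_inf.
rewrite /gyrochromatic_number -[inf Za]invrK lef_pV2 ?posrE ?invr_gt0//.
apply: ge_sup.
  exists 0, set0; last by rewrite measure0.
  split; first exact: measurable0.
  exists (fun=> 0) => u v _.
  by apply/seteqP; split=> // t [[? []]].
move=> _ [A [mA bA] <-]; apply/ler_addgt0Pr => eps eps0.
(* If [haar A] is at most [eps], the bound is immediate because the inverse of [inf Za] is
   nonnegative; otherwise [A] can be discretized. *)
have [epsA|] := ltP eps (fine (haar A)); last first.
  by move/le_trans; apply; rewrite lerDr invr_ge0 ltW.
have [n [S [cS hS muA]]] := circulant_of_coloring_base e_sym mA bA eps0 epsA.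
have Zz : Za (n.+1%:R / (independence_number (circulant S))%:R) by exists n, S.
rewrite -lerBlDr (le_trans muA)// -invf_div lef_pV2 ?posrE//.
  apply: ge_inf => //; exists 0 => z /sigma_ge[z_gt0 _]; exact: ltW.
by have [] := sigma_ge _ Zz.
Qed.
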